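(* For all real $\sigma>1$ and all real $x\geq 1$, the following three inequalities hold: $$\bigg|\frac{1}{\zeta(\sigma)}-\sum_{n \leq x} \frac{\mu(n)}{n^\sigma}\bigg| \leq \frac{2}{x^{\sigma-1}}\,\sup_{t \geq x}|m(t)|,$$ $$\bigg|\frac{1}{\zeta(\sigma)}-\sum_{n \leq x} \frac{\mu(n)}{n^\sigma}+\frac{m(x)}{x^{\sigma-1}}\bigg| \leq \frac{2(\sigma -1)}{x^{\sigma-1}}\,\sup_{t \geq x}|\check{m}(t)-1|,$$ $$\bigg|\frac{1}{\zeta(\sigma)}-\sum_{n \leq x} \frac{\mu(n)}{n^\sigma}+\frac{m(x)}{x^{\sigma-1}}+(\sigma-1)\frac{\check{m}(x)-1}{x^{\sigma-1}}\bigg| \leq \frac{(\sigma -1)^2}{x^{\sigma-1}}\,\sup_{t \geq x}|\check{\check{m}}(t)-2\log t+2\gamma|.$$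
   Context: $\mu$ is the Möbius function, $\zeta$ the Riemann zeta function, $\gamma$ Euler's constant. For real $x\geq 1$: $m(x)=\sum_{n\leq x}\frac{\mu(n)}{n}$, $\check{m}(x)=\sum_{n\leq x}\frac{\mu(n)}{n}\log(x/n)$, $\check{\check{m}}(x)=\sum_{n\leq x}\frac{\mu(n)}{n}\log^2(x/n)$. *)

(* Defs.v *)
From HB Require Import structures.
From mathcomp Require Import all_boot all_order all_algebra.
From mathcomp Require Import all_classical all_reals all_analysis.

Set Implicit Arguments.
Unset Strict Implicit.
Unset Printing Implicit Defensive.

Import Order.TTheory GRing.Theory Num.Theory.
Import numFieldNormedType.Exports.

Local Open Scope ring_scope.

(* Total on nat, with the harmless convention [moebius 0 = 0]. *)
Definition moebius (n : nat) : int :=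
  if (0 < n)%N && all (fun p : nat => ~~ (p ^ 2 %| n)%N) (primes n)
  then (-1) ^+ size (primes n) else 0.

(* Only meaningful for 1 < s, where the Dirichlet series converges;
   [riemannR s k] is 1 / (k + 1) ^ s. *)
Definition zeta (R : realType) (s : R) : R := limn (series (riemannR s)).

(* [series harmonic N] is 1 + 1/2 + ... + 1/N. *)
Definition euler_gamma (R : realType) : R :=
  limn (fun N : nat => series (@harmonic R) N - ln (N%:R : R)).

(* For 0 <= x, the integers 1 <= n <= x are those with
   1 <= n < (Num.truncn x).+1. *)
Definition dirichlet_moebius (R : realType) (s x : R) : R :=
  \sum_(1 <= n < (Num.truncn x).+1) (moebius n)%:~R / (n%:R `^ s).

Definition m (R : realType) (x : R) : R :=
  \sum_(1 <= n < (Num.truncn x).+1) (moebius n)%:~R / n%:R.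

Definition mcheck (R : realType) (x : R) : R :=
  \sum_(1 <= n < (Num.truncn x).+1) (moebius n)%:~R / n%:R * ln (x / n%:R).

Definition mcheckcheck (R : realType) (x : R) : R :=
  \sum_(1 <= n < (Num.truncn x).+1)
    (moebius n)%:~R / n%:R * (ln (x / n%:R)) ^+ 2.

(* The supremum of |f t| over t >= x, taken in the extended reals, so that it
   is a genuine least upper bound whether or not f is bounded on [x, +oo). *)
Definition sup_abs_ge (R : realType) (f : R -> R) (x : R) : \bar R :=
  ereal_sup [set (`|f t|)%:E | t in [set t : R | x <= t]]%classic.

(* Main.v *)
Require Import Defs.
From mathcomp Require Import all_boot all_order all_algebra.
From mathcomp Require Import all_classical all_reals all_analysis.
From mathcomp Require Import ring lra.
Import Order.TTheory GRing.Theory Num.Theory.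
Import numFieldNormedType.Exports.

(** Write [e = sigma - 1] and [D] for the Dirichlet partial sums.  All three
    inequalities come from integrating by parts along the chain
    [t * mcheck'(t) = m(t)] and [t * mcheckcheck'(t) = 2 * mcheck(t)].

    The middle quantity, [H(t) = 1/zeta - D(t) + m(t) / t^e], is the sum over
    all [n] of [mu(n)/n * min(n^-e, t^-e)]: it is continuous in [t], tends to
    [0] because [1/zeta] is the sum of [mu(n)/n^sigma], and away from the
    integers its derivative is [- e * m(t) * t^(-e-1)].  More generally, let
    [H' = - c * g * t^(-e-1)] with [H] tending to [0], and let [f] be an
    antiderivative of [g / t].  Then [K = H + c * f * t^-e] has derivative
    [- c * e * f * t^(-e-1)], which is of the same shape with [f] in place of
    [g].  If [|f| <= M] beyond [x], comparing [K] with [c * M * t^-e] gives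
    [|K(x)| <= c * M * x^-e], whence [|H(x)| <= 2 * c * M * x^-e]
    ([by_parts_bound]).

    The first inequality follows from comparing [H] itself with a multiple of
    [t^-e] ([cell_decay]), as [D] differs from [H] by [m(x) / x^e].  The second
    is [by_parts_bound] for [H] with [f = mcheck - 1].  The third is
    [by_parts_bound] one step further along the chain, with [g = mcheck - 1]
    and [f = (mcheckcheck - 2 ln + 2 gamma) / 2], whose factor [1/2] turns the
    constant [2 * e^2] into [e^2].

    No integral is formed: a function with a nonpositive derivative on every
    interval [[N, N+1]] and with limit [0] is nonnegative
    ([cell_derive_le0_ge0]).  The arithmetic input is that the Dirichlet
    partial sums of [mu] converge to [1/zeta] ([cvg_dirichlet_moebius]),
    obtained from Moebius inversion with an explicit bound on the tail of the
    zeta series. *)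

Local Open Scope classical_set_scope.
Local Open Scope ring_scope.

Set Implicit Arguments.
Unset Strict Implicit.
Unset Printing Implicit Defensive.

(** * Divisor sums of the Moebius function *)

Lemma big_multiples (V : nmodType) (d N : nat) (f : nat -> V) : (0 < d)%N ->
  \sum_(1 <= l < N.+1 | (d %| l)%N) f l =
  \sum_(1 <= k < (N %/ d).+1) f (d * k)%N.
Proof.
move=> d0; elim: N => [|N IHN]; first by rewrite div0n !big_geq.
rewrite big_mkcond big_nat_recr//= -big_mkcond/= IHN divnS//.
case: ifPn => [dvdN|_]; last by rewrite addr0 add0n.
rewrite add1n [RHS]big_nat_recr//=; congr (_ + f _).
have := divnK dvdN; rewrite divnS// dvdN add1n => <-; exact: mulnC.
Qed.

Lemma moebius_primeM (p d : nat) : prime p -> (0 < d)%N ->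
  moebius (p * d) = if (p %| d)%N then 0 else - moebius d.
Proof.
move=> pp d0; have p0 := prime_gt0 pp.
rewrite /moebius muln_gt0 p0 d0/=.
have [pd|pd] := boolP (p %| d)%N.
  suff /negbTE -> : ~~ all (fun q => ~~ (q ^ 2 %| p * d)%N) (primes (p * d))
    by [].
  apply/allPn; exists p.
    by rewrite mem_primes pp muln_gt0 p0 d0 dvdn_mulr.
  by rewrite negbK expnS expn1 dvdn_pmul2l.
have perm : perm_eq (primes (p * d)) (p :: primes d).
  apply: uniq_perm; rewrite ?primes_uniq//=.
    by rewrite primes_uniq andbT mem_primes pp d0.
  by move=> q; rewrite primesM// primes_prime// mem_seq1 inE.
rewrite (perm_all _ perm) (perm_size perm)/=.
rewrite expnS expn1 dvdn_pmul2l// pd/=.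
have -> : all (fun q => ~~ (q ^ 2 %| p * d)%N) (primes d) =
          all (fun q => ~~ (q ^ 2 %| d)%N) (primes d).
  apply: eq_in_all => q; rewrite mem_primes => /and3P[pq _ qd].
  rewrite Gauss_dvdr// coprimeXl// prime_coprime// dvdn_prime2//.
  by apply: contra pd => /eqP <-.
by case: ifP => _; rewrite ?oppr0// exprS mulN1r.
Qed.

(** Fix a prime [p] dividing [l = p * q].  The divisors of [l] that [p] divides
    are the [p * k] with [k] dividing [q]; only those with [k] prime to [p]
    contribute, with [- moebius k], and they cancel the contribution of the
    divisors of [l] prime to [p], which are the divisors of [q] prime to [p]. *)
Lemma sum_moebius_divisors (l : nat) : (0 < l)%N ->
  \sum_(1 <= d < l.+1 | (d %| l)%N) moebius d = (l == 1%N)%:R.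
Proof.
move=> l0; have [->|l1] := eqVneq l 1%N.
  by rewrite big_mkcond big_nat1 dvdnn.
set p := pdiv l.
have pp : prime p by rewrite pdiv_prime// ltn_neqAle eq_sym l1.
have [q lE] := dvdnP (pdiv_dvd l); rewrite -/p mulnC in lE.
have p0 := prime_gt0 pp.
have q0 : (0 < q)%N by move: l0; rewrite lE muln_gt0 => /andP[].
rewrite (bigID (fun d => p %| d)%N)/=.
rewrite (eq_bigl (fun d => (p %| d) && (d %| l))%N); last first.
  by move=> d; rewrite andbC.
rewrite big_mkcondr/= big_multiples// {1}lE mulKn//.
rewrite (@eq_big_nat _ _ _ _ _ _
  (fun k => if (k %| q) && ~~ (p %| k) then - moebius k else 0)%N); last first.
  move=> k /andP[k0 _]; rewrite lE dvdn_pmul2l// moebius_primeM//.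
  by case: (k %| q)%N => //=; case: (p %| k)%N.
rewrite -big_mkcond/= sumrN addrC.
apply/eqP; rewrite subr_eq0; apply/eqP.
rewrite (eq_bigl (fun d => (d %| q) && ~~ (p %| d))%N); last first.
  move=> d; have [|pd] := boolP (p %| d)%N; first by rewrite !andbF.
  by rewrite lE Gauss_dvdr// coprime_sym prime_coprime.
rewrite (big_nat_widen 1 q.+1 l.+1)//; last first.
  by rewrite ltnS dvdn_leq// lE dvdn_mull.
apply: eq_bigl => d; case: (boolP (d %| q)%N) => //= /(dvdn_leq q0).
by rewrite ltnS => ->; rewrite andbT.
Qed.

(** * The zeta series and its tail *)

Lemma inv_succ_le_lnB (R : realType) (n : nat) : (0 < n)%N ->
  (n.+1%:R : R)^-1 <= ln n.+1%:R - ln n%:R.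
Proof.
move=> n0; have n0' : 0 < n%:R :> R by rewrite ltr0n.
have n1 : 0 < n.+1%:R :> R by rewrite ltr0n.
rewrite -opprB lerNr -ln_div ?posrE//.
have -> : n%:R / n.+1%:R = 1 + - n.+1%:R^-1 :> R.
  apply: (mulIf (lt0r_neq0 n1)); rewrite mulfVK ?gt_eqF//.
  rewrite mulrDl mul1r mulNr mulVf ?gt_eqF//.
  by rewrite -natr1 addrK.
by apply: le_ln1Dx; rewrite ltrN2 invf_lt1// ltr1n ltnS.
Qed.

Lemma sum_inv_le (R : realType) (N : nat) : (0 < N)%N ->
  \sum_(1 <= n < N.+1) (n%:R : R)^-1 <= 1 + ln N%:R.
Proof.
case: N => // N _; elim: N => [|N IHN].
  by rewrite big_nat1 invr1 ln1 addr0.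
rewrite big_nat_recr//= (le_trans (lerD IHN (inv_succ_le_lnB _ (ltn0Sn N))))//.
by rewrite -addrA subrKC.
Qed.

(** The ratio of [n^-e] to [(n+1)^-e] is [exp (e * (ln (n+1) - ln n))], at least
    [1 + e / (n+1)].  Bounding the terms of the zeta series by a telescoping
    difference plays the part of the integral test. *)
Lemma powRN_succ_le (R : realType) (e : R) (n : nat) : 0 < e -> (0 < n)%N ->
  (n.+1%:R `^ (1 + e))^-1 <= (n%:R `^ (- e) - n.+1%:R `^ (- e)) / e.
Proof.
move=> e0 n0; have n0' : 0 < n%:R :> R by rewrite ltr0n.
have n1 : 0 < n.+1%:R :> R by rewrite ltr0n.
rewrite ler_pdivlMr// powRD ?(gt_eqF n1) ?implybT//.
rewrite (powRr1 (ltW n1)) invfM -powRN.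
have -> : n%:R `^ (- e) = n.+1%:R `^ (- e) * expR (e * (ln n.+1%:R - ln n%:R)).
  by rewrite /powR !gt_eqF// -expRD; congr expR; ring.
set p := _ `^ _; have p0 : 0 <= p by exact: powR_ge0.
rewrite -[X in _ <= _ - X]mulr1 -mulrBr mulrAC mulrC ler_wpM2l//.
rewrite lerBrDl (le_trans _ (expR_ge1Dx _))// lerD2l mulrC ler_pM2l//.
exact: inv_succ_le_lnB.
Qed.

Lemma series_riemannRE (R : realType) (s : R) (N : nat) :
  series (riemannR s) N = \sum_(1 <= n < N.+1) (n%:R `^ s)^-1.
Proof. by rewrite /series/= big_add1. Qed.

Lemma riemannR_tail (R : realType) (e : R) (K N : nat) : 0 < e -> (0 < K)%N ->
  (K <= N)%N ->
  series (riemannR (1 + e)) N - series (riemannR (1 + e)) K <=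
    K%:R `^ (- e) / e.
Proof.
move=> e0 K0 KN.
suff : series (riemannR (1 + e)) N - series (riemannR (1 + e)) K <=
    (K%:R `^ (- e) - N%:R `^ (- e)) / e.
  move/le_trans; apply; rewrite ler_pM2r ?invr_gt0// gerBl; exact: powR_ge0.
move: KN; elim: N => [|N IHN].
  by rewrite leqn0 => /eqP ->; rewrite !subrr mul0r.
rewrite leq_eqVlt => /predU1P[->|]; first by rewrite !subrr mul0r.
rewrite ltnS => KN; have N0 := leq_trans K0 KN.
rewrite seriesSr addrAC (le_trans (lerD (IHN KN) (powRN_succ_le e0 N0)))//.
rewrite -mulrDl. by rewrite subrKA.
Qed.

Lemma nondecreasing_series_riemannR (R : realType) (s : R) : 0 <= s ->
  nondecreasing_seq (series (riemannR s)).
Proof.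
by move=> s0; apply: nondecreasing_series => n _ _; apply/ltW/riemannR_gt0.
Qed.

Lemma is_cvg_riemannR (R : realType) (s : R) : 1 < s ->
  cvgn (series (riemannR s)).
Proof.
move=> s1; have e0 : 0 < s - 1 by rewrite subr_gt0.
have mono := nondecreasing_series_riemannR (ltW (lt_trans ltr01 s1)).
apply: nondecreasing_is_cvgn => //.
exists (1 + (s - 1)^-1) => _ [N _ <-].
(* Passing to [N.+1] ensures that the first term is in the sum. *)
apply: (le_trans (mono _ _ (leqnSn N))).
have := @riemannR_tail _ _ 1 N.+1 e0 isT isT.
rewrite powR1 subrKC mul1r lerBlDl => /le_trans; apply.
by rewrite seriesEnat/= big_nat1 /riemannR powR1 invr1.
Qed.

Lemma zeta_tail (R : realType) (s : R) (K : nat) : 1 < s -> (0 < K)%N ->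
  0 <= zeta s - series (riemannR s) K <= K%:R `^ (1 - s) / (s - 1).
Proof.
move=> s1 K0; have e0 : 0 < s - 1 by rewrite subr_gt0.
have cv := is_cvg_riemannR s1.
apply/andP; split.
  rewrite subr_ge0; apply: nondecreasing_cvgn_le => //.
  exact: nondecreasing_series_riemannR (ltW (lt_trans ltr01 s1)).
rewrite lerBlDr; apply: limr_le => //; near=> N.
rewrite -lerBlDr -[in leRHS](opprB s); have := @riemannR_tail _ _ K N e0 K0.
rewrite subrKC; apply; near: N; exact: nbhs_infty_ge.
Unshelve. all: by end_near. Qed.

Lemma cvg_powRN (R : realType) (e : R) : 0 < e ->
  (n%:R : R) `^ (- e) @[n --> \oo] --> 0.
Proof.
move=> e0; apply/cvgrPdist_le => d d0; near=> n.
rewrite sub0r normrN ger0_norm ?powR_ge0//.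
have n0 : 0 < n%:R :> R by rewrite ltr0n; near: n; exact: nbhs_infty_gt.
rewrite powRN -[leRHS]invrK lef_pV2 ?posrE ?invr_gt0 ?powR_gt0//.
have -> : d^-1 = ((d^-1) `^ (e^-1)) `^ e.
  by rewrite -powRrM mulVf ?gt_eqF// powRr1// invr_ge0 ltW.
apply: ge0_ler_powR; rewrite ?nnegrE ?powR_ge0 ?ltW//.
near: n; exact: nbhs_infty_gtr.
Unshelve. all: by end_near. Qed.

(** Each logarithmic factor is absorbed by half of the remaining exponent:
    [1 + ln n <= (1 + 2/e) * n^(e/2)]. *)
Lemma cvg_lnX_powRN (R : realType) (k : nat) (e : R) : 0 < e ->
  (1 + ln (n%:R : R)) ^+ k * n%:R `^ (- e) @[n --> \oo] --> 0.
Proof.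
elim: k e => [|k IHk] e e0.
  by under eq_fun do rewrite expr0 mul1r; exact: cvg_powRN.
have h0 : 0 < e / 2 by rewrite divr_gt0.
have lim0 : (1 + (e / 2)^-1) *
    ((1 + ln (n%:R : R)) ^+ k * n%:R `^ (- (e / 2))) @[n --> \oo] --> 0.
  rewrite -[X in _ --> X](mulr0 (1 + (e / 2)^-1)).
  by apply: cvgMr; exact: IHk.
apply: (squeeze_cvgr _ (cvg_cst 0) lim0).
near=> n.
have n1 : 1 <= n%:R :> R by rewrite ler1n; near: n; exact: nbhs_infty_gt.
have n0 : 0 < n%:R :> R by rewrite (lt_le_trans ltr01).
have l0 : 0 <= 1 + ln n%:R :> R by rewrite addr_ge0// ln_ge0.
rewrite mulr_ge0 ?exprn_ge0 ?powR_ge0//=.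
have -> : - e = - (e / 2) + - (e / 2) by lra.
rewrite powRD; last by rewrite (gt_eqF n0) implybT.
rewrite exprSr -!mulrA [leRHS]mulrCA ler_wpM2l ?exprn_ge0//.
rewrite mulrA ler_wpM2r ?powR_ge0//.
rewrite powRN ler_pdivrMr ?powR_gt0// mulrDl mul1r lerD//.
  by rewrite -[leLHS](powRr0 n%:R) ler_powR// ltW.
rewrite -ler_pdivrMl ?invr_gt0// invrK /powR gt_eqF//.
by apply: le_trans (expR_ge1Dx _); rewrite lerDr.
Unshelve. all: by end_near. Qed.

(** * The inverse of zeta as a Dirichlet series *)

Lemma norm_moebius_le1 (R : realType) (n : nat) :
  `|(moebius n)%:~R : R| <= 1.
Proof.
rewrite /moebius; case: ifP => _; last by rewrite mulr0z normr0.
by rewrite rmorphXn/= rmorphN1 normrX normrN1 expr1n.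
Qed.

(** Grouping the terms [mu(n) / (n * k)^s] of the double sum by the value of
    [n * k <= N] leaves the divisor sums of [mu], which vanish except at [1]. *)
Lemma sum_moebius_series (R : realType) (s : R) (N : nat) : (0 < N)%N ->
  \sum_(1 <= n < N.+1) (moebius n)%:~R / n%:R `^ s *
    series (riemannR s) (N %/ n)%N = 1.
Proof.
move=> N0.
transitivity (\sum_(1 <= n < N.+1) \sum_(1 <= l < N.+1 | (n %| l)%N)
    (moebius n)%:~R * (l%:R `^ s : R)^-1).
  rewrite big_nat [RHS]big_nat; apply: eq_bigr => n /andP[n0 _].
  rewrite series_riemannRE big_multiples// mulr_sumr.
  by apply: eq_bigr => k _; rewrite natrM powRM// invfM mulrA.
rewrite (exchange_big_dep_nat xpredT)//=.
rewrite big_ltn// [X in _ + X]big_nat [X in _ + X]big1 ?addr0.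
  rewrite -mulr_suml powR1 invr1 mulr1 big_mkcond big_ltn//=.
  rewrite big_nat big1 ?addr0// => n /andP[n1 _].
  by rewrite dvdn1 gtn_eqF.
move=> l /andP[l1 lN].
have l0 : (0 < l)%N by exact: ltn_trans l1.
rewrite -mulr_suml.
suff -> : \sum_(1 <= i < N.+1 | (i %| l)%N) (moebius i)%:~R = 0 :> R.
  by rewrite mul0r.
rewrite -raddf_sum/=.
transitivity ((\sum_(1 <= d < l.+1 | (d %| l)%N) moebius d)%:~R : R).
  congr (_ %:~R); rewrite (big_nat_widen 1 l.+1 N.+1)//.
  apply: eq_bigl => d; case: (boolP (d %| l)%N) => //= /(dvdn_leq l0).
  by rewrite ltnS => ->.
by rewrite sum_moebius_divisors// gtn_eqF.
Qed.

(** By [sum_moebius_series] the difference is the sum of [mu(n) / n^s] times the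
    tail of zeta beyond [K = N %/ n], which is at most [K^-e / e] with
    [e = s - 1].  As [K >= 1], one has [2 * K >= N / n], so each term is
    [O(N^-e / n)], and the harmonic sum costs one logarithm. *)
Lemma zeta_dirichlet_moebius_le (R : realType) (s : R) (N : nat) :
  1 < s -> (0 < N)%N ->
  `|dirichlet_moebius s N%:R * zeta s - 1| <=
  2 `^ (s - 1) / (s - 1) * ((1 + ln N%:R) * N%:R `^ (- (s - 1))).
Proof.
move=> s1 N0; have e0 : 0 < s - 1 by rewrite subr_gt0.
rewrite -[X in `|_ - X|](sum_moebius_series s N0) /dirichlet_moebius natrK.
rewrite mulr_suml -sumrB.
rewrite (le_trans (ler_norm_sum _ _ _))//.
apply: (@le_trans _ _ (\sum_(1 <= n < N.+1)
    2 `^ (s - 1) / (s - 1) * N%:R `^ (- (s - 1)) * n%:R^-1)); last first.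
  rewrite -mulr_sumr mulrA [leRHS]mulrAC ler_wpM2l ?sum_inv_le//.
  by rewrite mulr_ge0 ?divr_ge0 ?powR_ge0// ltW.
rewrite big_nat [leRHS]big_nat; apply: ler_sum => n /andP[n0].
rewrite ltnS => nN.
have n0' : 0 < n%:R :> R by rewrite ltr0n.
have N0' : 0 < N%:R :> R by rewrite ltr0n.
have K0 : (0 < N %/ n)%N by rewrite divn_gt0.
have K0' : 0 < (N %/ n)%N%:R :> R by rewrite ltr0n.
have /andP[t0 t1] := zeta_tail s1 K0.
rewrite -mulrBr normrM (ger0_norm t0) normrM normfV (ger0_norm (powR_ge0 _ _)).
have KN : (N %/ n)%N%:R `^ (1 - s) <=
    2 `^ (s - 1) * N%:R `^ (- (s - 1)) * n%:R `^ (s - 1).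
  rewrite -(opprB s) !powRN mulrAC ler_pdivlMr ?powR_gt0// mulrC.
  rewrite ler_pdivrMr ?powR_gt0// -!powRM ?mulr_ge0//.
  apply: ge0_ler_powR; rewrite ?nnegrE ?mulr_ge0//; first exact: ltW.
  rewrite -!natrM ler_nat mulnAC (leq_trans (ltnW (ltn_ceil N n0)))//.
  by rewrite leq_mul// mul2n -addnn -addn1 leq_add2l.
apply: (@le_trans _ _ (1 / n%:R `^ s *
    (2 `^ (s - 1) * N%:R `^ (- (s - 1)) * n%:R `^ (s - 1) / (s - 1)))).
  apply: ler_pM => //.
    by rewrite ler_wpM2r ?invr_ge0 ?powR_ge0 ?norm_moebius_le1.
  by rewrite (le_trans t1)// ler_wpM2r// invr_ge0 ltW.
have -> : n%:R `^ s = n%:R * n%:R `^ (s - 1) :> R.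
  by rewrite mulr_powRB1// (lt_trans ltr01).
have p0 := powR_gt0 (s - 1) n0'.
rewrite le_eqVlt; apply/orP; left; apply/eqP.
by field; rewrite !gt_eqF.
Qed.

Lemma zeta_gt0 (R : realType) (s : R) : 1 < s -> 0 < zeta s.
Proof.
move=> s1; have /andP[+ _] := zeta_tail s1 (ltn0Sn 0).
rewrite subr_ge0; apply: lt_le_trans.
by rewrite seriesEnat/= big_nat1 /riemannR powR1 invr1.
Qed.

Lemma cvg_dirichlet_moebius (R : realType) (s : R) : 1 < s ->
  dirichlet_moebius s (n%:R : R) @[n --> \oo] --> (zeta s)^-1.
Proof.
move=> s1; have e0 : 0 < s - 1 by rewrite subr_gt0.
have z0 := zeta_gt0 s1.
suff lim1 : dirichlet_moebius s (n%:R : R) * zeta s @[n --> \oo] --> (1 : R).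
  rewrite -[X in _ --> X]mul1r.
  under eq_fun do rewrite -[dirichlet_moebius _ _](mulfK (lt0r_neq0 z0)).
  by apply: cvgMl.
apply/cvgrPdist_le => d d0.
have lim0 : 2 `^ (s - 1) / (s - 1) *
    ((1 + ln (n%:R : R)) ^+ 1 * n%:R `^ (- (s - 1))) @[n --> \oo] --> 0.
  rewrite -[X in _ --> X](mulr0 (2 `^ (s - 1) / (s - 1))).
  by apply: cvgMr; exact: cvg_lnX_powRN.
near=> N.
have N0 : (0 < N)%N by near: N; exact: nbhs_infty_gt.
rewrite distrC (le_trans (zeta_dirichlet_moebius_le s1 N0))// -[1 + _]expr1.
by near: N; exact: cvgr_le lim0 _ _.
Unshelve. all: by end_near. Qed.

(** * Functions differentiable between consecutive integers *)

(** On [[1, +oo)], [f'] is the derivative of [f] from the right, and on each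
    closed interval between consecutive integers [f] is the restriction of a
    function differentiable on [(0, +oo)]: [f] is continuous, with kinks allowed
    at integers only.  The endpoint [N + 1] is included for [f], which gives
    continuity there, and excluded for [f'], which may jump. *)
Definition cell_derive (R : realType) (f f' : R -> R) : Prop :=
  forall N : nat, (0 < N)%N -> exists A B : R -> R,
    [/\ forall t : R, N%:R <= t <= N.+1%:R -> f t = A t,
        forall t : R, N%:R <= t < N.+1%:R -> f' t = B t
      & forall t : R, 0 < t -> is_derive t 1 A (B t)].

Lemma eq_cell_derive (R : realType) (f f' g g' : R -> R) :
  (forall t, 1 <= t -> g t = f t) -> (forall t, 1 <= t -> g' t = f' t) ->
  cell_derive f f' -> cell_derive g g'.
Proof.
move=> gf gf' df N N0; have [A [B [fA fB dA]]] := df N N0.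
have N1 : 1 <= N%:R :> R by rewrite ler1n.
exists A, B; split=> // t /andP[Nt tN].
  by rewrite gf ?fA ?Nt// (le_trans N1).
by rewrite gf' ?fB ?Nt// (le_trans N1).
Qed.

Lemma cell_derive_smooth (R : realType) (f f' : R -> R) :
  (forall t : R, 0 < t -> is_derive t 1 f (f' t)) -> cell_derive f f'.
Proof. by move=> df N _; exists f, f'. Qed.

Lemma cell_deriveD (R : realType) (f f' g g' : R -> R) :
  cell_derive f f' -> cell_derive g g' ->
  cell_derive (fun t => f t + g t) (fun t => f' t + g' t).
Proof.
move=> df dg N N0.
have [A [B [fA fB dA]]] := df N N0; have [C [D [gC gD dC]]] := dg N N0.
exists (A + C), (fun t => B t + D t); split=> [t Nt|t Nt|t t0].
- by rewrite fA// gC.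
- by rewrite fB// gD.
- by have := dA t t0; have := dC t t0 => ? ?; exact: is_deriveD.
Qed.

Lemma cell_deriveM (R : realType) (f f' g g' : R -> R) :
  cell_derive f f' -> cell_derive g g' ->
  cell_derive (fun t => f t * g t) (fun t => f' t * g t + f t * g' t).
Proof.
move=> df dg N N0.
have [A [B [fA fB dA]]] := df N N0; have [C [D [gC gD dC]]] := dg N N0.
exists (A * C), (fun t => B t * C t + A t * D t); split=> [t Nt|t Nt|t t0].
- by rewrite fA// gC.
- have Nt' : N%:R <= t <= N.+1%:R by case/andP: Nt => -> /ltW.
  by rewrite fB// gD// fA// gC.
- have := dA t t0; have := dC t t0 => ? ?.
  apply: is_derive_eq; rewrite addrC mulrC; congr (_ + _); exact: mulrC.
Qed.

Lemma cell_derive_cst (R : realType) (c : R) : cell_derive (fun=> c) (fun=> 0).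
Proof. by apply: cell_derive_smooth => t _; exact: is_derive_cst. Qed.

Lemma cell_deriveZ (R : realType) (c : R) (f f' : R -> R) :
  cell_derive f f' -> cell_derive (fun t => c * f t) (fun t => c * f' t).
Proof.
move=> df; have := cell_deriveM (cell_derive_cst c) df.
by apply: eq_cell_derive => t _; rewrite /cst/= ?mul0r ?add0r.
Qed.

Lemma cell_derive_powR (R : realType) (a : R) :
  cell_derive (fun t => t `^ a) (fun t => a * t `^ (a - 1)).
Proof. by apply: cell_derive_smooth => t t0; exact: is_derive1_powR. Qed.

Lemma cell_derive_ln (R : realType) : cell_derive (@ln R) (fun t => t^-1).
Proof. by apply: cell_derive_smooth => t t0; exact: is_derive1_ln. Qed.

(** A common form for [m], [mcheck], [mcheckcheck] and, with [phi] an
    exponential, for the remainder of the Dirichlet series. *)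
Definition ln_sum (R : realType) (b : nat -> R) (phi : R -> R) (t : R) : R :=
  \sum_(1 <= n < (Num.truncn t).+1) b n * phi (ln (t / n%:R)).

(** The term entering the sum when [t] reaches the integer [n] is
    [b n * phi (ln 1) = 0], so the sum has no jump. *)
Lemma cell_derive_ln_sum (R : realType) (b : nat -> R) (phi psi : R -> R) :
  phi 0 = 0 -> (forall u : R, is_derive u 1 phi (psi u)) ->
  cell_derive (ln_sum b phi) (fun t => ln_sum b psi t / t).
Proof.
move=> phi0 dphi N N0.
have truncE (t : R) : N%:R <= t < N.+1%:R -> Num.truncn t = N.
  exact: truncn_def.
pose S (g : R -> R) t := \sum_(1 <= n < N.+1) b n * g (ln (t / n%:R)).
exists (S phi), (fun t => S psi t / t); split=> [t /andP[Nt]|t Nt|t t0].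
- rewrite le_eqVlt => /predU1P[->|tN]; last by rewrite /ln_sum truncE ?Nt.
  rewrite /ln_sum natrK big_nat_recr//= divff ?pnatr_eq0// ln1 phi0.
  by rewrite mulr0 addr0.
- by rewrite /ln_sum truncE.
have term n : (0 < n)%N -> is_derive t 1 (fun t => b n * phi (ln (t / n%:R)))
    (b n * psi (ln (t / n%:R)) / t).
  move=> n0; have n0' : 0 < n%:R :> R by rewrite ltr0n.
  have dlin : is_derive t 1 (fun t : R => t / n%:R) (n%:R^-1).
    rewrite (_ : (fun t => _) = n%:R^-1 *: id); last first.
      by apply/funext => u; rewrite mulrC.
    apply: is_derive_eq; first exact: mulr1.
  have dln : is_derive (t / n%:R) 1 (@ln R) (t / n%:R)^-1.
    by apply: is_derive1_ln; rewrite divr_gt0.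
  have dl := @is_derive1_comp _ (@ln R) (fun t => t / n%:R) _ _ _ dln dlin.
  have dp := @is_derive1_comp _ phi _ _ _ _ (dphi _) dl.
  apply: (is_derive_eq (is_deriveZ (b n) dp)).
  rewrite /= -mulrA; congr (_ * (_ * _)).
  by field; rewrite !gt_eqF.
(* The range [1 <= n < k] is empty for both [k = 0] and [k = 1]. *)
rewrite /S; elim: N.+1 => [|k IHk].
  rewrite big_geq// mul0r (_ : (fun t => _) = cst 0).
    exact: is_derive_cst.
  by apply/funext => u; rewrite big_geq.
case: k IHk => [|k] IHk.
  rewrite big_geq// mul0r (_ : (fun t => _) = cst 0).
    exact: is_derive_cst.
  by apply/funext => u; rewrite big_geq.
rewrite big_nat_recr//= mulrDl.
have -> : (fun t : R => \sum_(1 <= n < k.+2) b n * phi (ln (t / n%:R))) =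
    (fun t => \sum_(1 <= n < k.+1) b n * phi (ln (t / n%:R))) +
    (fun t => b k.+1 * phi (ln (t / k.+1%:R))).
  by apply/funext => u; rewrite big_nat_recr.
by have := term k.+1 isT => ?; exact: is_deriveD.
Qed.

(** The function is nonincreasing on [[x, +oo)], hence bounded below by its
    limit. *)
Lemma cell_derive_le0_ge0 (R : realType) (f f' : R -> R) (x : R) :
  1 <= x -> cell_derive f f' -> (forall t, x <= t -> f' t <= 0) ->
  f n%:R @[n --> \oo] --> (0 : R) -> 0 <= f x.
Proof.
move=> x1 df f'0 f0.
have cell (N : nat) t : (0 < N)%N -> x <= t -> N%:R <= t < N.+1%:R ->
    f N.+1%:R <= f t.
  move=> N0 xt /[dup] Ntl /andP[Nt tN]; have [A [B [fA fB dA]]] := df N N0.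
  have t0 : 0 < t by rewrite (lt_le_trans _ Nt)// ltr0n.
  rewrite fA ?lexx ?ler_nat ?leqnSn// fA ?Nt ?(ltW tN)//.
  have [u utN|u|c ctN] := @MVT _ A B _ _ tN.
  - by apply: dA; move: utN; rewrite in_itv/= => /andP[/(lt_trans t0)].
  - apply: continuous_in_subspaceT => {}u /[!inE]/=.
    rewrite in_itv/= => /andP[tu _].
    have /dA[dAu _] : 0 < u by exact: lt_le_trans tu.
    by apply: differentiable_continuous; apply/derivable1_diffP.
  - move=> eqA; rewrite -subr_le0 eqA; move: ctN.
    rewrite in_itv/= => /andP[tc cN].
    rewrite mulr_le0_ge0 ?subr_ge0 ?(ltW tN)// -fB ?cN ?andbT; last first.
      by rewrite (le_trans Nt)// ltW.
    by apply: f'0; rewrite (le_trans xt)// ltW.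
set N := Num.truncn x.
have N0 : (0 < N)%N by rewrite truncn_gt0.
have x0 : 0 <= x by exact: le_trans x1.
have chain k : f (N + k).+1%:R <= f x.
  elim: k => [|k IHk].
    by rewrite addn0; apply: cell => //; exact: truncn_itv.
  apply: le_trans IHk; rewrite addnS; apply: cell => //.
    by rewrite (le_trans (ltW (truncnS_gt x)))// ler_nat ltnS leq_addr.
  by rewrite lexx ltr_nat ltnS leqnn.
apply: (cvgr_to_le f0); near=> n.
have Nn : (N < n)%N by near: n; exact: nbhs_infty_gt.
by rewrite -(subnKC Nn) addSn.
Unshelve. all: by end_near. Qed.

(** * Decay estimates and integration by parts *)

(** The derivative of [K t = c / e * M * t^-e] is [- c * M * t^(-e-1)], so that
    both [K + H] and [K - H] decrease to [0]. *)
Lemma cell_decay (R : realType) (e c M x : R) (H g : R -> R) :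
  0 < e -> 0 <= c -> 1 <= x ->
  cell_derive H (fun t => - c * g t * t `^ (- e - 1)) ->
  (forall t, x <= t -> `|g t| <= M) ->
  H n%:R @[n --> \oo] --> (0 : R) ->
  `|H x| <= c / e * M * x `^ (- e).
Proof.
move=> e0 c0 x1 dH gM H0.
pose K t := c / e * M * t `^ (- e).
have dK : cell_derive K (fun t => - c * M * t `^ (- e - 1)).
  have := cell_deriveZ (c / e * M) (cell_derive_powR (- e)).
  by apply: eq_cell_derive => t _ //; field; rewrite gt_eqF.
have K0 : K n%:R @[n --> \oo] --> (0 : R).
  by rewrite -[X in _ --> X](mulr0 (c / e * M)); apply: cvgMr; exact: cvg_powRN.
rewrite ler_norml -subr_ge0 opprK -[in X in _ && X]subr_ge0; apply/andP; split.
  apply: (@cell_derive_le0_ge0 _ (fun t => H t + K t) _ x x1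
    (cell_deriveD dH dK)).
    move=> t /gM; rewrite ler_norml => /andP[+ _] => gt.
    rewrite -mulrDl mulr_le0_ge0 ?powR_ge0// -mulrDr mulNr oppr_le0 mulr_ge0//.
    lra.
  by rewrite -[X in _ --> X]addr0; apply: cvgD.
have dHN := cell_deriveZ (- 1) dH.
apply: (@cell_derive_le0_ge0 _ (fun t => K t - H t)
  (fun t => - c * M * t `^ (- e - 1) + -1 * (- c * g t * t `^ (- e - 1)))
  x x1).
- by apply: eq_cell_derive (cell_deriveD dK dHN) => t _ //; rewrite mulN1r.
- move=> t /gM; rewrite ler_norml => /andP[_ gt].
  have p0 := powR_ge0 t (- e - 1).
  rewrite mulrA -mulrDl mulr_le0_ge0//.
  rewrite (_ : _ + _ = - (c * (M - g t))); last by ring.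
  by rewrite oppr_le0 mulr_ge0// subr_ge0.
- by rewrite -[X in _ --> X]subr0; apply: cvgB.
Qed.

(** In the derivative of [c * f * t^-e], the part [c * (g / t) * t^-e] cancels
    the derivative of [H]. *)
Lemma cell_derive_by_parts (R : realType) (e c : R) (H f g : R -> R) :
  cell_derive H (fun t => - c * g t * t `^ (- e - 1)) ->
  cell_derive f (fun t => g t / t) ->
  cell_derive (fun t => H t + c * (f t * t `^ (- e)))
              (fun t => - (c * e) * f t * t `^ (- e - 1)).
Proof.
move=> dH df.
have := cell_deriveD dH
  (cell_deriveZ c (cell_deriveM df (cell_derive_powR (- e)))).
apply: eq_cell_derive => t t1 //.
have t0 : 0 < t by exact: lt_le_trans t1.
have -> : t `^ (- e) = t * t `^ (- e - 1).
  by rewrite -{2}(powRr1 (ltW t0)) -powRD ?(gt_eqF t0) ?implybT// subrKC.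
by field; rewrite gt_eqF.
Qed.

Lemma cvg_bounded_powRN (R : realType) (e M x : R) (f : R -> R) : 0 < e ->
  (forall t, x <= t -> `|f t| <= M) ->
  f n%:R * n%:R `^ (- e) @[n --> \oo] --> (0 : R).
Proof.
move=> e0 fM; have lim0 : M * (n%:R : R) `^ (- e) @[n --> \oo] --> (0 : R).
  by rewrite -[X in _ --> X](mulr0 M); apply: cvgMr; exact: cvg_powRN.
apply/cvgrPdist_le => d d0; near=> n.
rewrite sub0r normrN normrM (ger0_norm (powR_ge0 _ _)).
apply: (@le_trans _ _ (M * n%:R `^ (- e))).
  rewrite ler_wpM2r ?powR_ge0// fM//.
  by near: n; exact: nbhs_infty_ger.
by near: n; exact: cvgr_le lim0 _ _.
Unshelve. all: by end_near. Qed.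
(** [H + c * f * t^-e] satisfies the hypotheses of [cell_decay], with [f] in
    place of [g] and [c * e] in place of [c]: this bounds it by [c * M * x^-e], and the correction
    [c * f x * x^-e] is bounded by the same quantity. *)
Lemma by_parts_bound (R : realType) (e c M x : R) (H f g : R -> R) :
  0 < e -> 0 <= c -> 1 <= x ->
  cell_derive H (fun t => - c * g t * t `^ (- e - 1)) ->
  cell_derive f (fun t => g t / t) ->
  H n%:R @[n --> \oo] --> (0 : R) ->
  (forall t, x <= t -> `|f t| <= M) ->
  `|H x| <= 2 * c * M * x `^ (- e).
Proof.
move=> e0 c0 x1 dH df H0 fM.
have f0 := cvg_bounded_powRN e0 fM.
have lim0 : H n%:R + c * (f n%:R * n%:R `^ (- e)) @[n --> \oo] --> (0 : R).
  rewrite -[X in _ --> X]addr0; apply: cvgD => //.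
  by rewrite -[X in _ --> X](mulr0 c); apply: cvgMr.
have := cell_decay e0 (mulr_ge0 c0 (ltW e0)) x1
  (cell_derive_by_parts dH df) fM lim0.
rewrite mulfK ?gt_eqF// => bound.
have -> : H x = (H x + c * (f x * x `^ (- e))) - c * (f x * x `^ (- e)) by ring.
rewrite (le_trans (ler_normB _ _))//.
have -> : 2 * c * M * x `^ (- e) = c * M * x `^ (- e) + c * (M * x `^ (- e)).
  by ring.
rewrite lerD// normrM (ger0_norm c0) ler_wpM2l//.
rewrite normrM (ger0_norm (powR_ge0 _ _)).
by rewrite ler_wpM2r ?powR_ge0// fM.
Qed.

Lemma norm_ln_sumX_le (R : realType) (b : nat -> R) (k N : nat) : (0 < N)%N ->
  (forall n, (0 < n)%N -> `|b n| <= n%:R^-1) ->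
  `|ln_sum b (fun u => u ^+ k) N%:R| <= (1 + ln N%:R) ^+ k.+1.
Proof.
move=> N0 bn; rewrite /ln_sum natrK (le_trans (ler_norm_sum _ _ _))//.
have N1 : 1 <= N%:R :> R by rewrite ler1n.
have lN : 0 <= ln N%:R :> R by rewrite ln_ge0.
apply: (@le_trans _ _ (\sum_(1 <= n < N.+1)
    n%:R^-1 * (1 + ln N%:R) ^+ k)); last first.
  by rewrite -mulr_suml exprS ler_wpM2r ?sum_inv_le// exprn_ge0// addr_ge0.
rewrite big_nat [leRHS]big_nat; apply: ler_sum => n /andP[n0].
rewrite ltnS => nN.
have n0' : 0 < n%:R :> R by rewrite ltr0n.
have Nn : 1 <= N%:R / n%:R :> R by rewrite ler_pdivlMr// mul1r ler_nat.
rewrite normrM ler_pM ?bn// normrX (ger0_norm (ln_ge0 Nn)).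
rewrite lerXn2r ?nnegrE ?ln_ge0 ?addr_ge0//.
rewrite ln_div ?posrE ?(lt_le_trans ltr01 N1)//.
have : 0 <= ln n%:R :> R by rewrite ln_ge0// ler1n.
lra.
Qed.

Lemma cvg_ln_sumX (R : realType) (e : R) (b : nat -> R) (k : nat) : 0 < e ->
  (forall n, (0 < n)%N -> `|b n| <= n%:R^-1) ->
  ln_sum b (fun u => u ^+ k) n%:R * n%:R `^ (- e) @[n --> \oo] --> (0 : R).
Proof.
move=> e0 bn; have lim0 := cvg_lnX_powRN k.+1 e0.
apply/cvgrPdist_le => d d0; near=> n.
have n0 : (0 < n)%N by near: n; exact: nbhs_infty_gt.
rewrite sub0r normrN normrM (ger0_norm (powR_ge0 _ _)).
apply: (@le_trans _ _ ((1 + ln n%:R) ^+ k.+1 * n%:R `^ (- e))).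
  by rewrite ler_wpM2r ?powR_ge0 ?norm_ln_sumX_le.
by near: n; exact: cvgr_le lim0 _ _.
Unshelve. all: by end_near. Qed.

(** When the supremum is infinite the right-hand side is [+oo]; otherwise it is
    a real number that bounds [|f|] beyond [x]. *)
Lemma le_mule_sup_abs_ge (R : realType) (f : R -> R) (x v c : R) : 0 < c ->
  (forall M, (forall t, x <= t -> `|f t| <= M) -> v <= c * M) ->
  (v%:E <= c%:E * sup_abs_ge f x)%E.
Proof.
move=> c0 vM.
have ub t : x <= t -> ((`|f t|)%:E <= sup_abs_ge f x)%E.
  by move=> xt; apply: ereal_sup_ubound; exists t.
move: ub; case: (sup_abs_ge f x) => [M| |] ub.
- by rewrite -EFinM lee_fin; apply: vM => t /ub; rewrite lee_fin.
- by rewrite gt0_muley ?lte_fin// leey.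
- by have := ub x (lexx x); rewrite leeNy_eq.
Qed.

(** * The sums over the Moebius function *)

Lemma cell_derive_ln_sumX (R : realType) (b : nat -> R) (k : nat) :
  cell_derive (ln_sum b (fun u => u ^+ k.+1))
              (fun t => k.+1%:R * ln_sum b (fun u => u ^+ k) t / t).
Proof.
have dX (u : R) : is_derive u 1 (fun u => u ^+ k.+1) (k.+1%:R * u ^+ k).
  have := is_deriveX k.+1 (is_derive_id u 1).
  by rewrite exprfctE => /is_derive_eq; apply; exact: mulr1.
have := cell_derive_ln_sum b (expr0n R k.+1) dX.
apply: eq_cell_derive => t _ //; congr (_ / _).
by rewrite /ln_sum mulr_sumr; apply: eq_bigr => n _; rewrite mulrCA.
Qed.

Definition moebius_div (R : realType) (n : nat) : R := (moebius n)%:~R / n%:R.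

Lemma norm_moebius_div (R : realType) (n : nat) : (0 < n)%N ->
  `|moebius_div R n| <= n%:R^-1.
Proof.
move=> n0; rewrite normrM (ger0_norm (_ : 0 <= n%:R^-1)) ?invr_ge0//.
by rewrite -[leRHS]mul1r ler_wpM2r ?invr_ge0 ?norm_moebius_le1.
Qed.

Lemma mE (R : realType) : @m R = ln_sum (moebius_div R) (fun u => u ^+ 0).
Proof.
by apply/funext => t; apply: eq_bigr => n _; rewrite expr0 mulr1.
Qed.

Lemma mcheckE (R : realType) :
  @mcheck R = ln_sum (moebius_div R) (fun u => u ^+ 1).
Proof. by []. Qed.

Lemma mcheckcheckE (R : realType) :
  @mcheckcheck R = ln_sum (moebius_div R) (fun u => u ^+ 2).
Proof. by []. Qed.

Lemma cell_derive_mcheckB1 (R : realType) :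
  cell_derive (fun t : R => mcheck t - 1) (fun t => m t / t).
Proof.
have := cell_deriveD (cell_derive_ln_sumX (moebius_div R) 0)
  (cell_derive_cst (- 1)).
by apply: eq_cell_derive => t _ //; rewrite mE addr0 mul1r.
Qed.

Lemma cell_derive_mcheckcheck (R : realType) (c : R) :
  cell_derive (fun t : R => 2^-1 * (mcheckcheck t - 2 * ln t + c))
              (fun t => (mcheck t - 1) / t).
Proof.
have := cell_deriveZ 2^-1 (cell_deriveD (cell_deriveD
  (cell_derive_ln_sumX (moebius_div R) 1)
  (cell_deriveZ (- 2) (cell_derive_ln R)))
  (cell_derive_cst c)).
apply: eq_cell_derive => t t1; first by rewrite mulNr.
rewrite addr0 mcheckE; field.
by rewrite gt_eqF// (lt_le_trans ltr01).
Qed.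

Definition zeta_inv_rem (R : realType) (s t : R) : R :=
  (zeta s)^-1 - dirichlet_moebius s t + m t * t `^ (- (s - 1)).

(** [mu(n) / n * t^-e] is [mu(n) / n^s * exp (- e * ln (t / n))] with
    [e = s - 1], which turns the remainder into an [ln_sum] whose [phi] vanishes
    at [0]. *)
Lemma zeta_inv_remE (R : realType) (s t : R) : 1 <= t ->
  zeta_inv_rem s t = (zeta s)^-1 +
    ln_sum (fun n => (moebius n)%:~R / n%:R `^ s)
           (fun u => expR (- (s - 1) * u) - 1) t.
Proof.
move=> t1; have t0 : 0 < t by exact: lt_le_trans t1.
rewrite /zeta_inv_rem -addrA; congr (_ + _).
rewrite /dirichlet_moebius /m /ln_sum mulr_suml addrC -sumrB.
rewrite big_nat [RHS]big_nat; apply: eq_bigr => n /andP[n0 _].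
have n0' : 0 < n%:R :> R by rewrite ltr0n.
rewrite mulrBr mulr1; congr (_ - _); rewrite -!mulrA; congr (_ * _).
rewrite ln_div ?posrE// /powR !gt_eqF// -[X in X^-1 * _ = _](lnK n0').
rewrite -!expRN -!expRD.
by congr expR; ring.
Qed.

Lemma cell_derive_zeta_inv_rem (R : realType) (s : R) :
  cell_derive (zeta_inv_rem s)
    (fun t => - (s - 1) * m t * t `^ (- (s - 1) - 1)).
Proof.
set e := s - 1.
have dphi (u : R) :
    is_derive u 1 (fun u => expR (- e * u) - 1) (- e * expR (- e * u)).
  have dlin : is_derive u 1 (fun u : R => - e * u) (- e).
    apply: (is_derive_eq (is_deriveZ (- e) (is_derive_id u 1))); exact: mulr1.
  have dexp := @is_derive1_comp _ (@expR R) (fun u => - e * u) _ _ _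
    (is_derive_expR _) dlin.
  have dexpB1 : is_derive u 1 (fun u => expR (- e * u) - 1) _ :=
    is_deriveB dexp (is_derive_cst (1 : R) u 1).
  apply: (is_derive_eq dexpB1).
  by rewrite subr0 mulrC.
have phi0 : expR (- e * 0) - 1 = 0 by rewrite mulr0 expR0 subrr.
have := cell_deriveD (cell_derive_cst (zeta s)^-1)
  (cell_derive_ln_sum (fun n => (moebius n)%:~R / n%:R `^ s) phi0 dphi).
apply: eq_cell_derive => t t1; first exact: zeta_inv_remE.
have t0 : 0 < t by exact: lt_le_trans t1.
rewrite add0r /ln_sum /m mulr_sumr !mulr_suml.
rewrite big_nat [RHS]big_nat; apply: eq_bigr => n /andP[n0 _].
have n0' : 0 < n%:R :> R by rewrite ltr0n.
have -> : n%:R `^ s = n%:R * n%:R `^ e.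
  by rewrite -{2}(powRr1 (ltW n0')) -powRD ?subrKC// (gt_eqF n0') implybT.
have -> : expR (- e * ln (t / n%:R)) = t `^ (- e) * n%:R `^ e.
  by rewrite ln_div ?posrE// /powR !gt_eqF// -expRD; congr expR; ring.
have -> : t `^ (- e) = t * t `^ (- e - 1).
  by rewrite -{2}(powRr1 (ltW t0)) -powRD ?(gt_eqF t0) ?implybT// subrKC.
have := powR_gt0 e n0' => p0.
by field; rewrite !gt_eqF.
Qed.

Lemma cvg_zeta_inv_rem (R : realType) (s : R) : 1 < s ->
  zeta_inv_rem s n%:R @[n --> \oo] --> (0 : R).
Proof.
move=> s1; have e0 : 0 < s - 1 by rewrite subr_gt0.
rewrite -[X in _ --> X]addr0; apply: cvgD.
  rewrite -(subrr (zeta s)^-1).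
  by apply: cvgB; [exact: cvg_cst|exact: cvg_dirichlet_moebius].
by rewrite mE; apply: cvg_ln_sumX => // n; exact: norm_moebius_div.
Qed.

Theorem proposition2 (R : realType) (sigma x : R)
    (hsigma : 1 < sigma) (hx : 1 <= x) :
  [/\ ((`|(zeta sigma)^-1 - dirichlet_moebius sigma x|)%:E
        <= (2 / x `^ (sigma - 1))%:E * sup_abs_ge (@m R) x)%E,
      ((`|(zeta sigma)^-1 - dirichlet_moebius sigma x
           + m x / x `^ (sigma - 1)|)%:E
        <= (2 * (sigma - 1) / x `^ (sigma - 1))%:E
           * sup_abs_ge (fun t : R => mcheck t - 1)%R x)%E
    & ((`|(zeta sigma)^-1 - dirichlet_moebius sigma x
           + m x / x `^ (sigma - 1)
           + (sigma - 1) * ((mcheck x - 1) / x `^ (sigma - 1))|)%:E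
        <= ((sigma - 1) ^+ 2 / x `^ (sigma - 1))%:E
           * sup_abs_ge (fun t : R => mcheckcheck t - 2 * ln t
                                  + 2 * euler_gamma R)%R x)%E].
Proof.
have e0 : 0 < sigma - 1 by rewrite subr_gt0.
have x0 : 0 < x by exact: lt_le_trans hx.
have dH := cell_derive_zeta_inv_rem sigma.
have H0 := cvg_zeta_inv_rem hsigma.
have HE : (zeta sigma)^-1 - dirichlet_moebius sigma x + m x / x `^ (sigma - 1) =
  zeta_inv_rem sigma x by rewrite -powRN.
have bn := @norm_moebius_div R.
have f1_0 : (mcheck (n%:R : R) - 1) * n%:R `^ (- (sigma - 1)) @[n --> \oo]
    --> (0 : R).
  rewrite (_ : (fun n : nat => _) = (fun n : nat => mcheck (n%:R : R) *
      n%:R `^ (- (sigma - 1)) - n%:R `^ (- (sigma - 1)))); last first.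
    by apply/funext => n; rewrite mulrBl mul1r.
  rewrite -[X in _ --> X](subr0 (0 : R)); apply: cvgB; last exact: cvg_powRN.
  by rewrite mcheckE; exact: cvg_ln_sumX.
split; apply: le_mule_sup_abs_ge => [|M fM].
- by rewrite divr_gt0 ?powR_gt0.
- have bound := cell_decay e0 (ltW e0) hx dH fM H0.
  rewrite divff ?gt_eqF// mul1r in bound.
  have -> : (zeta sigma)^-1 - dirichlet_moebius sigma x =
      zeta_inv_rem sigma x - m x * x `^ (- (sigma - 1)).
    by rewrite /zeta_inv_rem addrK.
  rewrite (le_trans (ler_normB _ _))// -powRN.
  have -> : 2 * x `^ (- (sigma - 1)) * M =
      M * x `^ (- (sigma - 1)) + M * x `^ (- (sigma - 1)) by ring.
  rewrite lerD// normrM (ger0_norm (powR_ge0 _ _)) ler_wpM2r ?powR_ge0//.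
  exact: fM.
- by rewrite divr_gt0 ?mulr_gt0 ?powR_gt0.
- rewrite HE -powRN [leRHS]mulrAC.
  exact: by_parts_bound e0 (ltW e0) hx dH (cell_derive_mcheckB1 R) H0 fM.
- by rewrite divr_gt0 ?exprn_gt0 ?powR_gt0.
- rewrite HE -powRN.
  have dH2 := cell_derive_by_parts dH (cell_derive_mcheckB1 R).
  have H2_0 : zeta_inv_rem sigma n%:R + (sigma - 1) * ((mcheck n%:R - 1) *
      n%:R `^ (- (sigma - 1))) @[n --> \oo] --> (0 : R).
    rewrite -[X in _ --> X]addr0; apply: cvgD => //.
    by rewrite -[X in _ --> X](mulr0 (sigma - 1)); apply: cvgMr.
  have f2M t : x <= t ->
      `|2^-1 * (mcheckcheck t - 2 * ln t + 2 * euler_gamma R)| <= 2^-1 * M.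
    by move=> xt; rewrite normrM gtr0_norm ?invr_gt0// ler_wpM2l ?invr_ge0 ?fM.
  have := by_parts_bound e0 (mulr_ge0 (ltW e0) (ltW e0)) hx dH2
    (cell_derive_mcheckcheck (2 * euler_gamma R)) H2_0 f2M.
  move/le_trans; apply; rewrite le_eqVlt; apply/orP; left; apply/eqP.
  by field.
Qed.
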